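(* Let $(X,d)$ be a locally connected metric space, $f:X\to X$ a continuous map, $n,l\in\mathbb{N}$ with $n,l\geq 2$, $\beta=(m_1,m_2,\dots,m_n)\in\mathbb{N}^n$ and $\alpha=(c_1,c_2,\dots,c_l)\in\mathbb{N}^l$. Suppose that, as sets, $\{m_1,m_2,\dots,m_n\}\subset\{c_1,c_2,\dots,c_l\}$ (inclusion, equality allowed). If $(X,f)$ is multi-sensitive with respect to $\alpha$, then $(X,f)$ is $\beta$-$n$-sensitive.
   Context: $\mathbb{N}=\{1,2,3,\dots\}$. For a continuous map $g:X\to X$, $U\subseteq X$ and $\delta>0$, let $N_g(U,\delta)=\{k\in\mathbb{N}: \exists x,y\in U \text{ with } d(g^k(x),g^k(y))>\delta\}$. - For $\alpha=(c_1,\dots,c_l)\in\mathbb{N}^l$, $(X,f)$ is multi-sensitive with respect to $\alpha$ if there is $\delta>0$ such that for all nonempty open sets $U_1,\dots,U_l\subseteq X$, $\bigcap_{i=1}^l N_{f^{c_i}}(U_i,\delta)\neq\emptyset$. - For $\beta=(m_1,\dots,m_n)\in\mathbb{N}^n$, $(X,f)$ is $\beta$-$n$-sensitive if there is $\delta>0$ such that for every nonempty open $U\subseteq X$ there are $k\in\mathbb{N}$ and $x_1,\dots,x_n\in U$ with $\min_{1\leq i<j\leq n}d(f^{m_ik}(x_i),f^{m_jk}(x_j))>\delta$. *)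

(* Defs.v *)
From mathcomp Require Import all_boot all_order all_algebra.
From mathcomp Require Import all_classical all_reals all_analysis.

Set Implicit Arguments.
Unset Strict Implicit.
Unset Printing Implicit Defensive.

Import Order.TTheory GRing.Theory Num.Theory.
Import numFieldNormedType.Exports.

Local Open Scope classical_set_scope.
Local Open Scope ring_scope.

Definition locally_connected (X : topologicalType) : Prop :=
  forall (x : X) (U : set X), nbhs x U ->
    exists V : set X, [/\ open V, connected V, V x & V `<=` U].

(* The sensitivity times are the positive integers, hence [(0 < k)%N]. *)
Definition sens_times (R : realType) (X : metricType R) (g : X -> X)
    (U : set X) (delta : R) : set nat :=
  [set k | (0 < k)%N /\
    exists x y, [/\ U x, U y & delta < mdist (iter k g x) (iter k g y)]].

Definition multi_sensitive (R : realType) (X : metricType R) (f : X -> X)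
    (l : nat) (c : 'I_l -> nat) : Prop :=
  exists2 delta : R, 0 < delta &
    forall U : 'I_l -> set X, (forall i, open (U i) /\ U i !=set0) ->
      \bigcap_i sens_times (iter (c i) f) (U i) delta !=set0.

(* The minimum over the pairs [i < j] exceeds [delta] iff each term does. *)
Definition n_sensitive (R : realType) (X : metricType R) (f : X -> X)
    (n : nat) (m : 'I_n -> nat) : Prop :=
  exists2 delta : R, 0 < delta &
    forall U : set X, open U -> U !=set0 ->
      exists k : nat, exists x : 'I_n -> X,
        [/\ (0 < k)%N, (forall i, U (x i)) &
          forall i j : 'I_n, (i < j)%N ->
            delta < mdist (iter (m i * k)%N f (x i)) (iter (m j * k)%N f (x j))].

(* Main.v *)
(* Inside any open set take a connected open V.  Multi-sensitivity applied to
   the constant family V gives one time k at which every f^(m_i k)(V) has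
   diameter > delta.  These images are connected, so the distance to a fixed
   point takes on each of them all the values of [0, delta]; there is then room
   to pick the points greedily, away from the ones already chosen. *)
Require Import Defs.
From mathcomp Require Import all_boot all_order all_algebra.
From mathcomp Require Import all_classical all_reals all_analysis.
From mathcomp Require Import lra.

Import Order.TTheory GRing.Theory Num.Theory.
Import numFieldNormedType.Exports.

Local Open Scope classical_set_scope.
Local Open Scope ring_scope.

(** Each [r] in [s] costs a factor 4: the quarter of [[a, b]] at the end farther from [r] lies at
    distance at least [(b - a) / 4] from [r], and the search continues inside it. *)
Lemma segment_avoid (R : realFieldType) (e a b : R) (s : seq R) :
  0 <= e -> e * 4 ^+ size s <= b - a ->
  exists2 t, a <= t <= b & forall r, r \in s -> e <= `|t - r|.
Proof.
move=> e0; elim: s a b => [|r s IHs] a b /=.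
  rewrite expr0 mulr1 => eab; exists a => //.
  by rewrite lexx /= -subr_ge0 (le_trans e0).
rewrite exprS mulrCA => eab.
(* Together with [eab] this gives [e <= (b - a) / 4], so the quarter that is kept avoids [r]. *)
have e4 : e <= e * 4 ^+ size s by rewrite ler_peMr// exprn_ege1// ler1n.
have [rab|rab] := lerP r ((a + b) / 2).
- have [|t tab ts] := IHs (b - (b - a) / 4) b; first lra.
  exists t => [|r']; first lra.
  rewrite inE => /predU1P[->|/ts//].
  apply: le_trans (ler_norm _); lra.
- have [|t tab ts] := IHs a (a + (b - a) / 4); first lra.
  exists t => [|r']; first lra.
  rewrite inE => /predU1P[->|/ts//].
  rewrite distrC; apply: le_trans (ler_norm _); lra.
Qed.

Lemma mdist_lipschitz (R : realType) (X : metricType R) (p x y : X) :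
  `|mdist p x - mdist p y| <= mdist x y.
Proof.
have := metric_triangle p x y; have := metric_triangle p y x.
by rewrite (metric_sym y x) ler_norml => *; apply/andP; split; lra.
Qed.

Lemma mdist_continuous (R : realType) (X : metricType R) (p : X) :
  continuous (mdist p : X -> R).
Proof.
move=> x; apply/cvgrPdist_lt => e e0.
apply/metricType_numDomainType.nbhs_mdistP; exists e => //= y xy.
exact: le_lt_trans (mdist_lipschitz _ _ _ _ _) xy.
Qed.

Lemma iter_continuous (T : topologicalType) (f : T -> T) (k : nat) :
  continuous f -> continuous (iter k f).
Proof.
move=> cf; elim: k => [|k IHk] x; first exact: cvg_id.
exact: continuous_comp (IHk x) (cf _).
Qed.

(** The map [mdist p] reduces the question to the real line: its image of [A] is an interval
    containing 0 and [mdist p q], and, being 1-Lipschitz, it carries separation of values back to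
    separation of points. *)
Lemma connected_avoid (R : realType) (X : metricType R) (A : set X) (e : R)
    (p q : X) (s : seq X) :
  connected A -> A p -> A q -> 0 <= e -> e * 4 ^+ size s <= mdist p q ->
  exists2 z, A z & forall y, y \in s -> e <= mdist z y.
Proof.
move=> cA Ap Aq e0 epq.
have [|t tpq ts] := @segment_avoid R e 0 (mdist p q) (map (mdist p) s) e0.
  by rewrite size_map subr0.
have /connected_intervalP itvA : connected (mdist p @` A : set R).
  apply: connected_continuous_connected => //.
  exact/continuous_subspaceT/mdist_continuous.
have [|||z Az zt] := itvA 0 (mdist p q) _ _ t.
- by exists p => //; rewrite mdistxx.
- by exists q.
- by [].
exists z => // y ys; apply: le_trans (mdist_lipschitz _ _ p _ _).
by rewrite zt; apply/ts/map_f.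
Qed.

(** Greedy choice by induction on [n]: the sets of nonzero index are served first, then [A ord0]
    supplies a point avoiding the [n] points already found. *)
Lemma connected_separated_points (R : realType) (X : metricType R) (n : nat)
    (A : 'I_n -> set X) (e : R) :
  0 <= e -> (forall i, connected (A i)) ->
  (forall i, exists x y, [/\ A i x, A i y & e * 4 ^+ n <= mdist x y]) ->
  exists2 x : 'I_n -> X, forall i, A i (x i) &
    forall i j : 'I_n, (i < j)%N -> e <= mdist (x i) (x j).
Proof.
move=> e0; elim: n A => [|n IHn] A cA dA.
  by exists (fun i : 'I_0 => False_rect X (notF (ltn_ord i))) => -[].
have [i|i|x Ax xe] := IHn (fun i => A (lift ord0 i)).
- exact: cA.
- have [p [q [Ap Aq pq]]] := dA (lift ord0 i).
  exists p, q; split=> //; apply: le_trans pq.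
  by rewrite ler_wpM2l// ler_weXn2l// ler1n.
have [p [q [Ap Aq pq]]] := dA ord0.
have [|z Az ze] := connected_avoid _ _ _ _ _ _ (codom x) (cA ord0) Ap Aq e0.
  apply: le_trans pq.
  by rewrite size_codom card_ord ler_wpM2l// ler_weXn2l// ler1n.
exists (fun i => oapp x z (unlift ord0 i)) => [i|i j].
  by case: unliftP => [j ->|->] /=.
case: (unliftP ord0 j) => [j' ->|->] //=.
case: (unliftP ord0 i) => [i' ->|->] //= ij; first exact: xe.
exact/ze/codom_f.
Qed.

Theorem theorem3 (R : realType) (X : metricType R) (f : X -> X)
    (n l : nat) (m : 'I_n -> nat) (c : 'I_l -> nat)
    (hX : locally_connected X) (hf : continuous f)
    (hn : (2 <= n)%N) (hl : (2 <= l)%N)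
    (hm : forall i, (0 < m i)%N) (hc : forall i, (0 < c i)%N)
    (hmc : range m `<=` range c) :
  multi_sensitive f c -> n_sensitive f m.
Proof.
move=> [d d0 fc]; pose e := d / 4 ^+ n.
have e0 : 0 < e by rewrite divr_gt0// exprn_gt0.
(* The points obtained are only [e] apart in the weak sense; halving makes the inequality strict. *)
exists (e / 2) => [|U oU [x0 Ux0]]; first by rewrite divr_gt0.
have [V [oV cV Vx0 VU]] := hX x0 U (open_nbhs_nbhs (conj oU Ux0)).
have [i|k kc] := fc (fun=> V); first by split=> //; exists x0.
have k0 : (0 < k)%N.
  (* Positivity of [k] is read off at index 0 of ['I_l]. *)
  by have [] := kc (Ordinal (ltnW hl)) I.
have [|i|i|y Ay ye] := @connected_separated_points R X n
    (fun i => iter (m i * k) f @` V) e.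
- exact: ltW.
- apply: connected_continuous_connected => //.
  exact/continuous_subspaceT/iter_continuous.
- have [j _ cjm] := hmc _ (imageT m i).
  have [_ [x [y [Vx Vy xy]]]] := kc j I.
  rewrite -!iterM cjm mulnC in xy.
  exists (iter (m i * k) f x), (iter (m i * k) f y); split.
  + by exists x.
  + by exists y.
  + by rewrite /e divfK ?ltW// expf_neq0.
(* Pull each separated point [y i] back to a point of [V]. *)
have [x Vx] := choice (fun i => let: ex_intro2 x Vx xy := Ay i in
  ex_intro (fun x => V x /\ iter (m i * k) f x = y i) x (conj Vx xy)).
exists k, x; split=> // [i|i j ij]; first by apply: VU; case: (Vx i).
rewrite (Vx i).2 (Vx j).2; apply: lt_le_trans (ye _ _ ij).
by rewrite ltr_pdivrMr// ltr_pMr// ltr1n.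
Qed.
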